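(* Let $\mathbf{x}$ be a uniformly recurrent sequence. Then either (a) $\mathbf{x}$ is reversal-closed, so that $\rho_{\mathbf{x}} = \mathrm{Refl}_{\mathbf{x}}$ and $r_{\mathbf{x}} = \frac{1}{2}(\rho_{\mathbf{x}} + \mathrm{Pal}_{\mathbf{x}})$; or else (b) there exists $n_0$ such that $\rho_{\mathbf{x}}(n) = \mathrm{Unr}_{\mathbf{x}}(n)$ for all $n \geq n_0$ (so $\mathbf{x}$ has no reflected factor, and in particular no palindrome, of length $\ge n_0$), and consequently $r_{\mathbf{x}}(n) = \rho_{\mathbf{x}}(n)$ for all $n \geq n_0$.
   Context: A factor of a sequence is a finite contiguous block. $\mathbf{x}$ is uniformly recurrent if every factor $w$ occurs in every block of length $m(w)$ for some $m(w)$. For $u=u(1)\cdots u(m)$, $u^R=u(m)\cdots u(1)$; a palindrome satisfies $u=u^R$. $\rho_{\mathbf{x}}(n)$ is the number of distinct length-$n$ factors; $r_{\mathbf{x}}(n)$ the number of distinct length-$n$ factors up to $u\sim v\iff v\in\{u,u^R\}$; $\mathrm{Pal}_{\mathbf{x}}(n)$ the number of length-$n$ palindromic factors; $\mathrm{Refl}_{\mathbf{x}}(n)$ the number of length-$n$ factors $w$ with $w^R$ also a factor; $\mathrm{Unr}_{\mathbf{x}}(n)$ the number of length-$n$ factors $w$ with $w^R$ not a factor. $\mathbf{x}$ is reversal-closed if $w^R$ is a factor for every factor $w$. *)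

(* Defs.v *)
From mathcomp Require Import all_boot all_order all_algebra.
From mathcomp Require Import boolp.
Set Implicit Arguments.
Unset Strict Implicit.
Unset Printing Implicit Defensive.

Section Factors.
Variables (A : finType) (x : nat -> A).
Implicit Types (n : nat) (w : seq A).

Definition block (i n : nat) : seq A := mkseq (fun k => x (i + k)) n.

Definition is_factor w : Prop := exists i n, w = block i n.

Definition uniformly_recurrent : Prop :=
  forall w, is_factor w -> exists m, forall i, infix w (block i m).

Definition reversal_closed : Prop :=
  forall w, is_factor w -> is_factor (rev w).

Definition palindrome w : bool := w == rev w.

Definition factors n : {set n.-tuple A} :=
  [set w : n.-tuple A | `[< is_factor w >]].

Definition refl_equiv n : rel (n.-tuple A) :=
  fun u v => (v == u :> seq A) || (v == rev u :> seq A).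

Definition rho n : nat := #|factors n|.

Definition r n : nat := #|equivalence_partition (@refl_equiv n) (factors n)|.

Definition Pal n : nat := #|[set w in factors n | palindrome w]|.

Definition Refl n : nat := #|[set w in factors n | `[< is_factor (rev w) >]]|.

Definition Unr n : nat := #|[set w in factors n | ~~ `[< is_factor (rev w) >]]|.

End Factors.

(* Main.v *)
Require Import Defs.
From mathcomp Require Import all_boot all_order all_algebra.
From mathcomp Require Import boolp.
Import GRing.Theory.
Local Open Scope ring_scope.

(** If some factor [w] has a reversal that is not a factor, then by uniform
    recurrence every sufficiently long factor [u] contains [w], so [rev u]
    contains [rev w] and cannot be a factor; long reversal classes are then
    singletons.  Otherwise each reversal class [{w, rev w}] consists of factors
    and contributes exactly 2 to [rho + Pal]: two non-palindromes, or one
    palindrome counted twice. *)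

Section Factors.
Context {A : finType} {x : nat -> A}.

(** In [v = p ++ u ++ s], read as a block starting at [i], the copy of [u] starts at
    [i + size p]. *)
Lemma infix_is_factor (u v : seq A) :
  infix u v -> is_factor x v -> is_factor x u.
Proof.
case/infixP=> p [s ->] [i [n def_v]]; exists (i + size p)%N, (size u).
have size_n : size (p ++ u ++ s) = n by rewrite def_v size_mkseq.
apply: (@eq_from_nth _ (x 0)) => [|k lt_k]; first by rewrite size_mkseq.
have := congr1 (nth (x 0) ^~ (size p + k)%N) def_v.
rewrite !nth_cat ltnNge leq_addr /= addKn lt_k => ->.
rewrite !nth_mkseq ?addnA // -size_n !size_cat ltn_add2l.
exact: leq_trans lt_k (leq_addr _ _).
Qed.

Lemma long_factor_unreflected (w : seq A) :
    uniformly_recurrent x -> is_factor x w -> ~ is_factor x (rev w) ->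
  exists n0, forall u, is_factor x u -> (n0 <= size u)%N ->
    ~ is_factor x (rev u).
Proof.
move=> hx w_fac w_unr; have [m w_in] := hx w w_fac.
exists m => _ [i [n ->]]; rewrite size_mkseq => le_mn rev_fac; apply: w_unr.
apply: infix_is_factor rev_fac; rewrite infix_rev.
(* [w] occurs already in the first [m] letters: [block i m] is a prefix of [block i n]. *)
apply: infix_trans (w_in i) _; rewrite -(subnKC le_mn).
by rewrite /block /mkseq iotaD map_cat prefix_infix ?prefix_prefix.
Qed.

(** Comparing tuples instead of their underlying sequences lets [eqP] yield equations that rewrite
    the tuples themselves. *)
Lemma refl_equiv_tupleE n (u v : n.-tuple A) :
  refl_equiv u v = (v == u) || (v == [tuple of rev u]).
Proof. by []. Qed.

Lemma refl_equiv_equivalence n : equivalence_rel (@refl_equiv A n).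
Proof.
move=> u v w; split=> [|/orP[] /eqP eq_v]; first by rewrite /refl_equiv eqxx.
  by rewrite /refl_equiv eq_v.
by rewrite /refl_equiv eq_v revK orbC.
Qed.

Lemma double_r_reversal_closed n :
  reversal_closed x -> (2 * r x n = rho x n + Pal x n)%N.
Proof.
move=> closed; set D := factors x n.
have partP : partition (equivalence_partition (@refl_equiv A n) D) D.
  by apply: equivalence_partitionP => u v w _ _ _; exact: refl_equiv_equivalence.
rewrite /rho /Pal -/D -!sum1_card.
(* With [Pal] as a sum of indicators, [rho + Pal] gives each factor [w] the weight
   [1 + palindrome w], and the total splits along the classes. *)
rewrite [X in (_ + X)%N](_ : _ = \sum_(w in D) palindrome w)%N; last first.
  rewrite (eq_bigl (fun w => (w \in D) && palindrome w)) => [|w].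
    by rewrite big_mkcondr; apply: eq_bigr => w _; case: palindrome.
  by rewrite inE.
rewrite -big_split /= (set_partition_big _ partP) /=.
rewrite (eq_bigr (fun=> 2%N)) ?sum_nat_const 1?mulnC // => _ /imsetP[w Dw ->].
(* Closure keeps [rev w] in [D], so the class of [w] is the whole pair. *)
have Drw : [tuple of rev w] \in D.
  by move: Dw; rewrite !inE => /asboolP/closed; exact/asboolT.
have -> : [set v in D | refl_equiv w v] = [set w; [tuple of rev w]].
  apply/setP=> v; rewrite !inE refl_equiv_tupleE.
  apply/andb_idl => /orP[]/eqP->; first by move: Dw; rewrite inE.
  by move: Drw; rewrite inE.
(* The pair collapses to one word of weight 2, or has two words of weight 1. *)
have [pal_w | npal_w] := boolP (palindrome w).
  have <- : w = [tuple of rev w] by apply/val_inj/eqP.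
  by rewrite setUid big_set1 pal_w.
rewrite big_setU1 ?inE // big_set1 /palindrome /= revK.
by rewrite eq_sym [rev w == _]eq_sym -/(palindrome _) (negPf npal_w).
Qed.

Lemma r_eq_rho n :
    (forall w, is_factor x w -> size w = n -> ~ is_factor x (rev w)) ->
  r x n = rho x n.
Proof.
(* [rho] is recounted as the number of singletons [[set w]]; it remains to see that each class is
   one. *)
move=> unr; rewrite /r /rho -[RHS](card_imset _ set1_inj); congr #|pred_of_set _|.
apply: eq_in_imset => w; rewrite inE => /asboolP w_fac.
apply/setP=> v; rewrite !inE refl_equiv_tupleE.
have [-> | _] /= := eqVneq v w; first by rewrite andbT; exact/asboolP.
apply/negP=> /andP[/asboolP v_fac /eqP eq_v].
by apply: (unr w w_fac (size_tuple w)); rewrite eq_v in v_fac.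
Qed.

End Factors.

Theorem theorem3p5 (A : finType) (x : nat -> A)
    (hx : uniformly_recurrent x) :
  (reversal_closed x /\
   (forall n : nat, rho x n = Refl x n) /\
   (forall n : nat,
      (r x n)%:R = 1 / 2 * ((rho x n)%:R + (Pal x n)%:R) :> rat))
  \/
  (~ reversal_closed x /\
   exists n0 : nat,
     (forall n : nat, (n0 <= n)%N -> rho x n = Unr x n) /\
     (forall w : seq A, is_factor x w -> (n0 <= size w)%N ->
        ~ is_factor x (rev w) /\ ~ palindrome w) /\
     (forall n : nat, (n0 <= n)%N -> r x n = rho x n)).
Proof.
have [closed | nclosed] := pselect (reversal_closed x); [left | right].
  split=> //; split=> n.
    apply: eq_card => w; rewrite !inE; apply/esym/andb_idr.
    by move=> /asboolP/closed; exact: asboolT.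
  by rewrite -natrD -double_r_reversal_closed // natrM mulrA divfK ?mul1r.
split=> //; have [w w_fac w_unr] : exists2 w, is_factor x w & ~ is_factor x (rev w).
  apply: contrapT => none; apply: nclosed => w w_fac.
  by apply: contrapT => w_unr; apply: none; exists w.
have [n0 unr] := long_factor_unreflected w hx w_fac w_unr.
exists n0; split=> [n le_n|]; [|split=> [u u_fac le_u | n le_n]].
- apply: eq_card => u; rewrite !inE; apply/esym/andb_idr => /asboolP u_fac.
  by apply/asboolPn/unr; rewrite ?size_tuple.
(* A palindromic factor is its own reversal, hence reflected. *)
- have u_unr := unr u u_fac le_u; split=> // /eqP u_pal.
  by apply: u_unr; rewrite -u_pal.
- by apply: r_eq_rho => u u_fac size_u; apply: unr; rewrite ?size_u.
Qed.
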